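(* Let $q\equiv 3\pmod 4$ be a prime power, let $a\in\mathbb{F}_q^*$ be a square in $\mathbb{F}_q^*$, let $b\in\mathbb{F}_q$ satisfy $b^2=a$, and let $n$ be an odd positive integer such that $\operatorname{rad}(n+1)$ divides $q-1$. Then for every irreducible factor $f(x)$ of $E_n(x,a)$ in $\mathbb{F}_q[x]$ there exist $\alpha\in\mathbb{F}_{q^2}^*$ and a positive divisor $t$ of $\frac{2(n+1)}{\gcd(2(n+1),q-1)}$ satisfying (i) $\alpha^{2(n+1)/t}=1$, (ii) $\operatorname{rad}(t)$ divides $\operatorname{ord}_{q^2}(\alpha)$, (iii) $\gcd\left(t,\frac{q^2-1}{\operatorname{ord}_{q^2}(\alpha)}\right)=1$, (iv) $(\alpha,t)\notin\{(1,1),(-1,1)\}$, such that $f(x)$ has the following form: (a) $f(x)=D_t(x,a)-b^t(\alpha+\alpha^{-1})$ in the case that $\alpha\in\mathbb{F}_q^*$ or $\alpha^{q+1}=1$; (b) $f(x)=\left(D_t(x,a)-b^t(\alpha+\alpha^{-1})\right)\left(D_t(x,a)-b^t(\alpha^q+\alpha^{-q})\right)$ in the case that $\alpha$ satisfies neither of the conditions in (a).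
   Context: For $n\ge 1$ and $a\in\mathbb{F}_q$, the $n$-th Dickson polynomials of the first and second kind with parameter $a$ are $D_n(x,a)=\sum_{i=0}^{\lfloor n/2\rfloor}\frac{n}{n-i}\binom{n-i}{i}(-a)^i x^{n-2i}$ and $E_n(x,a)=\sum_{i=0}^{\lfloor n/2\rfloor}\binom{n-i}{i}(-a)^i x^{n-2i}$ in $\mathbb{F}_q[x]$ (the numbers $\frac{n}{n-i}\binom{n-i}{i}$ are integers, viewed in $\mathbb{F}_q$). $\operatorname{rad}(n)$ is the product of the distinct primes dividing $n$, with $\operatorname{rad}(1)=1$. $\operatorname{ord}_{q^2}(\alpha)$ is the multiplicative order of $\alpha$ in the cyclic group $\mathbb{F}_{q^2}^*$. Irreducible factors are normalized to be monic. *)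

(* Defs.v *)
From HB Require Import structures.
From mathcomp Require Import all_boot all_order all_algebra all_fingroup all_field.

Set Implicit Arguments.
Unset Strict Implicit.
Unset Printing Implicit Defensive.

Import GRing.Theory.
Local Open Scope ring_scope.

Definition radn (n : nat) : nat := (\prod_(p <- primes n) p)%N.

(* The integer n / (n - i) * 'C(n - i, i), for n > 0 and i <= n / 2; the
   division is exact by dickson_coefP. *)
Definition dickson_coef (n i : nat) : nat := ((n * 'C(n - i, i)) %/ (n - i))%N.

Lemma dickson_coefP (n i : nat) : (i <= n./2)%N ->
  (dickson_coef n i * (n - i) = n * 'C(n - i, i))%N.
Proof.
move=> le_i; rewrite divnK //.
have le_in : (i <= n)%N.
  by move: le_i; rewrite geq_half_double; apply: leq_trans; rewrite -addnn leq_addr.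
rewrite -{2}(subnK le_in) mulnDl dvdn_addr; last exact: dvdn_mulr.
case: i {le_i le_in} => [|i]; first by rewrite mul0n dvdn0.
by rewrite -mul_bin_diag dvdn_mulr.
Qed.

(* For n > 0 only: dickson1 0 a is 0, not the conventional D_0 = 2. *)
Definition dickson1 (R : comNzRingType) (n : nat) (a : R) : {poly R} :=
  \sum_(i < n./2.+1) ((dickson_coef n i)%:R * (- a) ^+ i) *: 'X^(n - 2 * i).

Definition dickson2 (R : comNzRingType) (n : nat) (a : R) : {poly R} :=
  \sum_(i < n./2.+1) ('C(n - i, i)%:R * (- a) ^+ i) *: 'X^(n - 2 * i).

(* Main.v *)
(* Write a root of f in an algebraic closure as x = b(z + 1/z).  Since E_n(x, a)
   is b^n (z^(n+1) - z^-(n+1)) / (z - 1/z), z is a root of unity whose order d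
   divides 2(n+1), and z <> 1, -1.  Put t = d / gcd(d, q^2 - 1) and
   alpha = z^t, which has order gcd(d, q^2 - 1) and hence lies in F_{q^2}.
   As D_t(x, a) = b^t (z^t + z^-t), x is a root of the polynomial claimed to
   equal f; that polynomial descends to F_q, so f divides it.  Conversely
   deg f >= D for D the period of x under the q-Frobenius; z^(q^D) is z or 1/z,
   so z is fixed by the D-th power of the q^2-Frobenius, and t | D because the
   valuations of (Q^m - 1)/(Q - 1) and m agree at the primes dividing t
   (Q = q^2).  When alpha + 1/alpha is not in F_q, D = t is impossible, so
   D >= 2t. *)
Require Import Defs.
From HB Require Import structures.
From mathcomp Require Import all_boot all_order all_algebra all_fingroup all_field.
From mathcomp Require Import cyclic zify ring.

Set Implicit Arguments.
Unset Strict Implicit.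
Unset Printing Implicit Defensive.

Import GRing.Theory.

(** * Radicals and prime divisors *)

Lemma dvdn_prod_primes (s : seq nat) (m : nat) :
  uniq s -> (forall p, p \in s -> prime p && (p %| m)) ->
  \prod_(p <- s) p %| m.
Proof.
elim: s => [|p s IHs] /=; first by rewrite big_nil dvd1n.
case/andP=> p_s uniq_s dv_s; rewrite big_cons.
have /andP[p_pr p_m] := dv_s p (mem_head p s).
have dv_s' r : r \in s -> prime r && (r %| m).
  by move=> r_s; apply: dv_s; rewrite inE r_s orbT.
rewrite Gauss_dvd ?p_m ?IHs // big_seq.
apply: (big_ind (coprime p)) => [|x y cx cy|r r_s].
- exact: coprimen1.
- by rewrite coprimeMr cx.
have /andP[r_pr _] := dv_s' r r_s.
by rewrite prime_coprime // dvdn_prime2 //; apply: contraNneq p_s => ->.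
Qed.

Lemma dvdn_radn (m n : nat) :
  (forall p, prime p -> p %| m -> p %| n) -> radn m %| n.
Proof.
move=> dv_m; apply: dvdn_prod_primes (primes_uniq m) _ => p.
by rewrite mem_primes => /and3P[p_pr _ /dv_m->]; rewrite ?p_pr.
Qed.

Lemma dvdn_prime_radn (p m : nat) :
  0 < m -> prime p -> p %| m -> p %| radn m.
Proof.
move=> m_gt0 p_pr p_m; rewrite /radn (bigD1_seq p) ?primes_uniq //=.
  by rewrite dvdn_mulr.
by rewrite mem_primes p_pr m_gt0.
Qed.

(** * Geometric sums modulo a prime and modulo its square *)

Lemma geom_sum_mod (Q m r : nat) :
  Q = 1 %[mod r] -> \sum_(i < m) Q ^ i = m %[mod r].
Proof.
move=> Q1; rewrite -modn_summ.
rewrite (eq_bigr (fun=> 1 %% r)) => [|i _].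
  by rewrite modn_summ sum1_card card_ord.
by rewrite -modnXm Q1 modnXm exp1n.
Qed.

Lemma geom_sumM (Q m p : nat) : 1 < Q ->
  (\sum_(i < p * m) Q ^ i = (\sum_(i < p) Q ^ i) * \sum_(i < m) (Q ^ p) ^ i).
Proof.
move=> Q_gt1; apply/eqP; rewrite -(@eqn_pmul2l Q.-1); last by rewrite -subn1 subn_gt0.
by rewrite mulnA -!predn_exp expnM.
Qed.

(** With Q = 1 + c p one has Q^i = 1 + i c p modulo p^2, so the sum is p + c p 'C(p, 2), and p
    divides 'C(p, 2) when p is odd. For p = 2 the sum is 1 + Q, which is why Q must be 1 modulo
    4. *)
Lemma geom_sum_prime_mod_sqr (Q p : nat) : prime p -> 0 < Q ->
  Q = 1 %[mod p] -> (p = 2 -> Q = 1 %[mod 4]) ->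
  \sum_(i < p) Q ^ i = p %[mod p ^ 2].
Proof.
move=> p_pr Q_gt0 Q1 Q4.
have [p2|p_neq2] := eqVneq p 2.
  by move: (Q4 p2); rewrite p2 2!big_ord_recl big_ord0 /= expn0 expn1; lia.
have [c defQ] : exists c, Q = (c * p).+1.
  exists (Q.-1 %/ p); rewrite divnK ?prednK //.
  by rewrite -subn1 -eqn_mod_dvd //; apply/eqP.
have expQ i : (Q ^ i) = (1 + i * (c * p)) %[mod p ^ 2].
  elim: i => [//|i IHi]; rewrite expnSr -modnMml IHi modnMml defQ.
  have -> : ((1 + i * (c * p)) * (c * p).+1
             = (i * c ^ 2) * p ^ 2 + (1 + i.+1 * (c * p))) by ring.
  by rewrite modnMDl.
rewrite -modn_summ (eq_bigr (fun i : 'I_p => (1 + i * (c * p)) %% p ^ 2));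
  last by move=> i _; rewrite expQ.
rewrite modn_summ big_split /= sum1_card card_ord -big_distrl /=.
rewrite -(big_mkord xpredT id) bin2_sum.
have /dvdnP[k ->] : (p %| 'C(p, 2)).
  by apply: prime_dvd_bin => //=; have := prime_gt1 p_pr; lia.
have -> : (p + k * p * (c * p) = (k * c) * p ^ 2 + p) by ring.
by rewrite modnMDl.
Qed.

(* Split off a prime p of t: \sum_(i < p * m') Q ^ i is the product of
   \sum_(i < p) Q ^ i, which is p times an integer prime to t, and of
   \sum_(i < m') (Q ^ p) ^ i, to which induction applies with t / p. *)
Lemma dvdn_geom_sum (t Q m : nat) : 0 < t -> 1 < Q ->
  (forall p, prime p -> p %| t -> Q = 1 %[mod p]) ->
  (2 %| t -> Q = 1 %[mod 4]) ->
  t %| \sum_(i < m) Q ^ i -> t %| m.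
Proof.
have [s] := ubnP t; elim: s t Q m => // s IHs t Q m lt_ts t_gt0 Q_gt1 Qp Q4 t_sum.
have [t_le1|t_gt1] := leqP t 1; first by rewrite (_ : t = 1) ?dvd1n //; lia.
have p_pr := pdiv_prime t_gt1; have p_t := pdiv_dvd t.
set p := pdiv t in p_pr p_t; have p_gt1 := prime_gt1 p_pr.
have p_m : (p %| m).
  have := dvdn_trans p_t t_sum.
  by rewrite /dvdn geom_sum_mod ?Qp.
case/dvdnP: p_m t_sum => m' ->; rewrite mulnC geom_sumM // => t_sum.
have Sp : (\sum_(i < p) Q ^ i) = p %[mod p ^ 2].
  apply: geom_sum_prime_mod_sqr (Qp p p_pr p_t) _ => //; first lia.
  by move=> p2; apply: Q4; rewrite -p2.
have [k defS] : exists k, (\sum_(i < p) Q ^ i = p * (k * p).+1).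
  exists ((\sum_(i < p) Q ^ i) %/ p ^ 2).
  have lt_p : (p < p ^ 2) by rewrite -{1}[p]expn1 ltn_exp2l.
  by rewrite {1}(divn_eq (\sum_(i < p) Q ^ i) (p ^ 2)) Sp modn_small //; ring.
(* A common prime r of t and k p + 1 divides the sum, which is congruent to p modulo r; hence r = p,
   and then p divides 1. *)
have co_tk : coprime t (k * p).+1.
  apply: contraT => nco_tk.
  have g_gt1 : (1 < gcdn t (k * p).+1).
    by rewrite ltn_neqAle eq_sym nco_tk gcdn_gt0 t_gt0.
  have r_pr := pdiv_prime g_gt1; have := pdiv_dvd (gcdn t (k * p).+1).
  set r := pdiv _ in r_pr *; rewrite dvdn_gcd => /andP[r_t r_k].
  have r_p : (r %| p).
    have : (r %| \sum_(i < p) Q ^ i) by rewrite defS dvdn_mull.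
    by rewrite /dvdn geom_sum_mod ?Qp.
  by move: r_k; rewrite (dvdn_prime2 r_pr p_pr) // in r_p *; rewrite (eqP r_p)
    -addn1 dvdn_addr ?dvdn_mull // dvdn1 gtn_eqF.
have t_sum' : (t %/ p %| \sum_(i < m') (Q ^ p) ^ i).
  rewrite -(dvdn_pmul2l (ltnW p_gt1)) mulnC divnK //.
  by rewrite -(Gauss_dvdr _ co_tk) mulnA (mulnC _ p) -defS.
rewrite -(divnK p_t) mulnC dvdn_pmul2l ?(ltnW p_gt1) //.
apply: IHs t_sum' => //.
- by rewrite -ltnS; apply: leq_trans lt_ts; rewrite ltnS ltn_Pdiv.
- by rewrite (divn_gt0 _ (ltnW p_gt1)) dvdn_leq.
- by rewrite -(exp1n p) (ltn_exp2r _ _ (ltnW p_gt1)).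
- move=> r r_pr r_t; rewrite -modnXm Qp ?modnXm ?exp1n //.
  by rewrite -(divnK p_t) dvdn_mulr.
- move=> t2; rewrite -modnXm Q4 ?modnXm ?exp1n //.
  by rewrite -(divnK p_t) dvdn_mulr.
Qed.

Local Open Scope ring_scope.

(** * Recurrence, degree and values of Dickson polynomials *)

Section DicksonPolynomials.

Variable R : comNzRingType.
Implicit Types (a u v : R) (n m : nat).

(* 'C(n - i, i) = 0 for i > n / 2, which hides the truncated exponents n - 2 * i. *)
Lemma dickson2_widen n m a : (n./2 < m)%N ->
  dickson2 n a = \sum_(i < m) ('C(n - i, i)%:R * (- a) ^+ i) *: 'X^(n - 2 * i).
Proof.
move=> lt_nm; rewrite /dickson2 (big_ord_widen m
  (fun i => ('C(n - i, i)%:R * (- a) ^+ i) *: 'X^(n - 2 * i)) lt_nm).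
rewrite big_mkcond /=; apply: eq_bigr => i _.
by case: ltnP => // lt_ni; rewrite bin_small ?mul0r ?scale0r //; lia.
Qed.

Lemma dickson2_0 a : dickson2 0 a = 1.
Proof. by rewrite /dickson2 big_ord1 bin0 !mul1r scale1r. Qed.

Lemma dickson2_1 a : dickson2 1 a = 'X.
Proof. by rewrite /dickson2 big_ord1 bin0 !mul1r scale1r. Qed.

(** Coefficientwise this is Pascal's rule. *)
Lemma dickson2_rec n a :
  dickson2 n.+2 a = 'X * dickson2 n.+1 a - a *: dickson2 n a.
Proof.
rewrite (@dickson2_widen n.+2 n.+3); last by lia.
rewrite (@dickson2_widen n.+1 n.+3); last by lia.
rewrite (@dickson2_widen n n.+2); last by lia.
rewrite scaler_sumr -sumrN mulr_sumr [LHS]big_ord_recl [X in _ = X + _]big_ord_recl.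
rewrite -addrA; congr (_ + _).
  by rewrite /= !subn0 !bin0 -scalerAr -exprS.
rewrite -big_split; apply: eq_bigr => i _; rewrite !lift0 (subSS i n.+1) (subSS i n).
rewrite -scalerAr -exprS scalerA -scaleNr.
have [le_i|lt_i] := leqP (2 * i) n.
  have -> : (n.+1 - i = (n - i).+1)%N by lia.
  rewrite binS natrD mulrDl scalerDl; congr (_ + _).
    (* For n = 2 i the truncated subtraction makes the exponents disagree, but the binomial
       coefficient in front is 0. *)
    have [eq_ni|ne_ni] := eqVneq n (2 * i)%N.
      by rewrite bin_small ?mul0r ?scale0r //; lia.
    by congr (_ *: _ ^+ _); lia.
  congr (_ *: 'X^_); first by rewrite exprS; ring.
  lia.
rewrite (_ : 'C(n.+1 - i, i.+1) = 0)%N; last by rewrite bin_small //; lia.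
rewrite (_ : 'C(n - i, i.+1) = 0)%N; last by rewrite bin_small //; lia.
rewrite (_ : 'C(n - i, i) = 0)%N; last by rewrite bin_small //; lia.
by rewrite !mul0r mulr0 oppr0 !scale0r [RHS]addr0.
Qed.

Lemma dickson1_1 a : dickson1 1 a = 'X.
Proof. by rewrite /dickson1 big_ord1 /dickson_coef divnn /= !mul1r scale1r. Qed.

(** Rests on m/(m - k) 'C(m - k, k) = 'C(m - k, k) + 'C(m - k - 1, k - 1), checked after multiplying
    by m - k. It transfers the size and the values of [dickson2] to [dickson1]. *)
Lemma dickson1E n a : dickson1 n.+2 a = dickson2 n.+2 a - a *: dickson2 n a.
Proof.
rewrite /dickson1 /dickson2 scaler_sumr -sumrN [LHS]big_ord_recl.
rewrite [X in _ = X + _]big_ord_recl -addrA; congr (_ + _).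
  by rewrite /dickson_coef subn0 !bin0 muln1 divnn.
rewrite -big_split; apply: eq_bigr => i _; rewrite !lift0.
have le_i : (2 * i <= n)%N by case: i => i /=; lia.
have -> : (n.+2 - 2 * i.+1 = n - 2 * i)%N by lia.
rewrite -[RHS]/(_ + _) scalerA -scaleNr -scalerDl; congr (_ *: _).
have -> : dickson_coef n.+2 i.+1 = ('C(n.+2 - i.+1, i.+1) + 'C(n - i, i))%N.
  apply/eqP; rewrite -(@eqn_pmul2r (n.+2 - i.+1)); last by lia.
  apply/eqP; rewrite dickson_coefP; last by lia.
  have -> : (n.+2 - i.+1 = (n - i).+1)%N by lia.
  rewrite mulnDl [X in _ = (_ + X)%N]mulnC mul_bin_diag.
  rewrite [X in _ = (X + _)%N]mulnC -mulnDl.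
  by congr (_ * _)%N; lia.
by rewrite natrD exprS; ring.
Qed.

Lemma dickson2_monic_size n a :
  dickson2 n a \is monic /\ size (dickson2 n a) = n.+1.
Proof.
have [m] := ubnP n; elim: m n => // m IHm [|[|n]] lt_nm.
- by rewrite dickson2_0 monic1 size_poly1.
- by rewrite dickson2_1 monicX size_polyX.
have [mon1 size1] := IHm n.+1 lt_nm.
have [_ size0] := IHm n (ltnW lt_nm).
have sizeX : size ('X * dickson2 n.+1 a) = n.+3.
  by rewrite mulrC size_mulX ?size1 // monic_neq0.
have lt_size : (size (- (a *: dickson2 n a)) < size ('X * dickson2 n.+1 a)%R)%N.
  rewrite size_polyN sizeX; apply: leq_ltn_trans (size_scale_leq _ _) _.
  by rewrite size0; lia.
rewrite dickson2_rec monicE lead_coefDl // lead_coef_Mmonic // lead_coefX.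
by rewrite size_polyDl // sizeX eqxx.
Qed.

Lemma dickson1_monic_size n a : (0 < n)%N ->
  dickson1 n a \is monic /\ size (dickson1 n a) = n.+1.
Proof.
case: n => [|[|n]] // _; first by rewrite dickson1_1 monicX size_polyX.
have [mon2 size2] := dickson2_monic_size n.+2 a.
have [_ size0] := dickson2_monic_size n a.
have lt_size : (size (- (a *: dickson2 n a)) < size (dickson2 n.+2 a))%N.
  rewrite size_polyN size2; apply: leq_ltn_trans (size_scale_leq _ _) _.
  by rewrite size0; lia.
by rewrite dickson1E monicE lead_coefDl // size_polyDl // size2 -monicE mon2.
Qed.

(** Both sides obey the same recurrence. The sum is (u^(n+1) - v^(n+1)) / (u - v) written without
    division, so that u = v is covered. *)
Lemma dickson2_hornerD n u v :
  (dickson2 n (u * v)).[u + v] = \sum_(i < n.+1) u ^+ (n - i) * v ^+ i.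
Proof.
have sumS k : \sum_(i < k.+2) u ^+ (k.+1 - i) * v ^+ i
    = u * (\sum_(i < k.+1) u ^+ (k - i) * v ^+ i) + v ^+ k.+1.
  rewrite big_ord_recr /= subnn mul1r; congr (_ + _); rewrite mulr_sumr.
  apply: eq_bigr => i _; rewrite mulrA -exprS; congr (_ ^+ _ * _).
  by have := ltn_ord i; lia.
have [m] := ubnP n; elim: m n => // m IHm [|[|n]] lt_nm.
- by rewrite dickson2_0 hornerC big_ord1 mul1r.
- by rewrite dickson2_1 hornerX sumS big_ord1 /= !mulr1.
rewrite dickson2_rec !hornerE (IHm n.+1) // (IHm n (ltnW lt_nm)).
by rewrite (sumS n.+1) (sumS n) [v ^+ n.+2]exprS; ring.
Qed.

(** By [dickson1E], subtracting u v times the shorter sum removes all but the two end terms. *)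
Lemma dickson1_hornerD n u v : (0 < n)%N ->
  (dickson1 n (u * v)).[u + v] = u ^+ n + v ^+ n.
Proof.
case: n => [|[|n]] // _; first by rewrite dickson1_1 hornerX.
rewrite dickson1E !hornerE !dickson2_hornerD big_ord_recl big_ord_recr.
rewrite [X in _ + (X + _)](_ : _ = u * v * \sum_(i < n.+1) u ^+ (n - i) * v ^+ i).
  by rewrite /= /bump /= add1n subn0 subnn; ring.
rewrite mulr_sumr; apply: eq_bigr => i _; rewrite !lift0 /= /bump /=.
have -> : (n.+2 - i.+1 = (n - i).+1)%N by have := ltn_ord i; lia.
by rewrite !exprS; ring.
Qed.

End DicksonPolynomials.

Lemma map_dickson1 (R S : comNzRingType) (h : {rmorphism R -> S}) n (a : R) :
  map_poly h (dickson1 n a) = dickson1 n (h a).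
Proof.
rewrite /dickson1 rmorph_sum; apply: eq_bigr => i _.
by rewrite /= map_polyZ map_polyXn rmorphM rmorph_nat rmorphXn rmorphN.
Qed.

Lemma map_dickson2 (R S : comNzRingType) (h : {rmorphism R -> S}) n (a : R) :
  map_poly h (dickson2 n a) = dickson2 n (h a).
Proof.
rewrite /dickson2 rmorph_sum; apply: eq_bigr => i _.
by rewrite /= map_polyZ map_polyXn rmorphM rmorph_nat rmorphXn rmorphN.
Qed.

(** * Frobenius powers in an extension of a finite field *)

Section FiniteSubfield.

Variables (F : finFieldType) (K : fieldType) (h : {rmorphism F -> K}).
Local Notation q := #|F|.

Lemma card_exp_eq0 i : (q ^ i == 0)%N = false.
Proof. by rewrite expn_eq0 eqn0Ngt ltnW ?finNzRing_gt1. Qed.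

Lemma pchar_pnat_card_exp i : [pchar K].-nat (q ^ i)%N.
Proof.
have [p p_pr pF] := finPcharP F.
by rewrite (card_pprimeChar pF) !pnatX pnatE // (rmorph_pchar h pF).
Qed.

Lemma frobeniusD i (x y : K) : (x + y) ^+ (q ^ i) = x ^+ (q ^ i) + y ^+ (q ^ i).
Proof. by rewrite exprDn_pchar ?pchar_pnat_card_exp. Qed.

Lemma frobenius_inj i : injective (fun x : K => x ^+ (q ^ i)).
Proof.
move=> x y /= eq_xy; apply/eqP; rewrite -subr_eq0.
have : (x - y) ^+ (q ^ i) == 0.
  by rewrite -(inj_eq (addIr (y ^+ (q ^ i)))) -frobeniusD subrK add0r eq_xy.
by rewrite expf_eq0 => /andP[].
Qed.

Lemma expf_card_exp i (c : F) : c ^+ (q ^ i) = c.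
Proof. by elim: i => // i IHi; rewrite expnS exprM expf_card. Qed.

(** X^q - X splits over [F] as the product of all X - c, so its roots in [K] are exactly the images
    of elements of [F]. *)
Lemma mem_codom_frobenius x : (x \in codom h) = (x ^+ q == x).
Proof.
apply/codomP/eqP => [[c ->]|xq]; first by rewrite -rmorphXn expf_card.
have := congr1 (fun p => (map_poly h p).[x]) (finField_genPoly F).
rewrite rmorphB /= map_polyXn map_polyX !hornerE xq subrr rmorph_prod.
rewrite horner_prod => /esym/eqP/prodf_eq0[c _].
by rewrite rmorphB /= map_polyX map_polyC hornerXsubC subr_eq0 => /eqP; exists c.
Qed.

Lemma horner_frobenius i (p : {poly F}) x :
  (map_poly h p).[x ^+ (q ^ i)] = (map_poly h p).[x] ^+ (q ^ i).
Proof.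
elim/poly_ind: p => [|p c IHp].
  by rewrite rmorph0 !horner0 expr0n card_exp_eq0.
rewrite rmorphD rmorphM /= map_polyX map_polyC !hornerE IHp frobeniusD exprMn.
by rewrite -rmorphXn expf_card_exp.
Qed.

(** The powers x^(q^i) with i < D are all roots of [p], and they are distinct: by injectivity of
    Frobenius a coincidence would give a shorter period. *)
Lemma frobenius_period_lt_size (p : {poly F}) x D :
    p != 0 -> root (map_poly h p) x ->
    (forall i, 0 < i < D -> x ^+ (q ^ i) != x)%N ->
  (D < size p)%N.
Proof.
move=> p_neq0 px0 minD.
rewrite -(size_map_poly h) -(size_iota 0 D).
rewrite -(size_map (fun i => x ^+ (q ^ i)) (iota 0 D)).
apply: max_poly_roots; first by rewrite map_poly_eq0.
  apply/allP=> _ /mapP[i _ ->]; rewrite rootE horner_frobenius.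
  by rewrite (rootP px0) expr0n card_exp_eq0.
rewrite map_inj_in_uniq ?iota_uniq //.
suff main i k : (i < k < D)%N -> x ^+ (q ^ i) != x ^+ (q ^ k).
  move=> i k; rewrite !mem_iota /= => lt_i lt_k /= eq_x.
  have [lt_ik|lt_ki|//] := ltngtP i k.
    by have := main i k; rewrite lt_ik lt_k eq_x eqxx => /(_ isT).
  by have := main k i; rewrite lt_ki lt_i eq_x eqxx => /(_ isT).
case/andP=> lt_ik lt_kD; rewrite -(subnK (ltnW lt_ik)) expnD exprM.
rewrite (inj_eq (@frobenius_inj i)) eq_sym; apply: minD; lia.
Qed.

(** Otherwise [p] and [r] are coprime, and coprimality survives the extension to [K], excluding a
    common root. *)
Lemma irreducible_dvdp_root (p r : {poly F}) x :
    irreducible_poly p -> root (map_poly h p) x -> root (map_poly h r) x ->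
  p %| r.
Proof.
move=> irr_p px0 rx0; apply: contraTT px0 => ndvd.
move: ndvd; rewrite -(irreducible_poly_coprime _ irr_p) -(coprimep_map h).
by rewrite coprimep_sym => /coprimep_root/(_ rx0).
Qed.

End FiniteSubfield.

Lemma monic_dvdp_eq (F : fieldType) (p r : {poly F}) :
  p \is monic -> r \is monic -> p %| r -> (size r <= size p)%N -> p = r.
Proof.
move=> p_mon r_mon p_r le_rp; apply/eqP; rewrite -eqp_monic // -dvdp_size_eqp //.
by rewrite eqn_leq le_rp dvdp_leq ?monic_neq0.
Qed.

(** * The substitution x = b z + b / z, and divisibility by d / gcd(d, m) *)

Lemma add_inv_inj (K : fieldType) (x y : K) : x != 0 -> y != 0 ->
  x + x^-1 = y + y^-1 -> x = y \/ x = y^-1.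
Proof.
move=> x0 y0 eq_xy.
have : (x - y) * (x * y - 1) == 0.
  rewrite (_ : _ * _ = x * y * (x + x^-1 - (y + y^-1))); last by field; rewrite ?x0 ?y0.
  by rewrite eq_xy subrr mulr0.
rewrite mulf_eq0 !subr_eq0 => /orP[/eqP|/eqP xy1]; [by left | right].
by apply: (mulIf y0); rewrite mulVf.
Qed.

(** Take z to be a root of z^2 = (x / b) z - 1; the constant term forces z to be nonzero. *)
Lemma closed_add_div (K : closedFieldType) (b x : K) : b != 0 ->
  exists2 z, z != 0 & x = b * z + b / z.
Proof.
move=> b0.
have [z] := @solve_monicpoly K 2 (fun i => if i == 0%N then -1 else x / b) isT.
rewrite 2!big_ord_recl big_ord0 /= mulr1 addr0 expr1 => z_root.
have z0 : z != 0.
  apply: contra_eqN z_root => /eqP->.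
  by rewrite !mulr0 addr0 expr0n eq_sym oppr_eq0 oner_neq0.
exists z => //; apply: (mulIf (mulf_neq0 b0 z0)).
rewrite [RHS](_ : _ * (b * z) = b ^+ 2 * (z ^+ 2 + 1)); last by field; rewrite ?b0 ?z0.
by rewrite z_root; field; rewrite ?b0 ?z0.
Qed.

(** With N = s d, multiplying by gcd(d, m) and cancelling d leaves gcd(s d, m) | s gcd(d, m) = gcd(s
    d, s m). *)
Lemma dvdn_div_gcd_mul (d N m : nat) : (0 < d)%N -> (d %| N)%N ->
  (d %/ gcdn d m * gcdn N m %| N)%N.
Proof.
move=> d_gt0 /dvdnP[s ->].
have e_gt0 : (0 < gcdn d m)%N by rewrite gcdn_gt0 d_gt0.
rewrite -(dvdn_pmul2r e_gt0) mulnAC divnK ?dvdn_gcdl //.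
rewrite [X in (_ %| X)%N]mulnAC mulnC dvdn_pmul2r // muln_gcdr dvdn_gcd dvdn_gcdl.
by rewrite dvdn_mull ?dvdn_gcdr.
Qed.

Lemma coprime_div_gcd (d m : nat) : (0 < d)%N ->
  coprime (d %/ gcdn d m) (m %/ gcdn d m).
Proof.
move=> d_gt0; have e_gt0 : (0 < gcdn d m)%N by rewrite gcdn_gt0 d_gt0.
rewrite /coprime -(eqn_pmul2r e_gt0) mul1n muln_gcdl.
by rewrite !divnK ?dvdn_gcdl ?dvdn_gcdr.
Qed.

(** Factor Q^m - 1 as Q - 1 times a geometric sum and cancel e = gcd(d, Q - 1): since d / e is prime
    to (Q - 1) / e, it divides the sum, and [dvdn_geom_sum] applies. *)
Lemma dvdn_div_gcd_pred (d Q m : nat) : (0 < d)%N -> (1 < Q)%N ->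
    (forall p, prime p -> p %| d -> p %| Q.-1)%N -> (Q = 1 %[mod 4])%N ->
  (d %| (Q ^ m).-1)%N -> (d %/ gcdn d Q.-1 %| m)%N.
Proof.
move=> d_gt0 Q_gt1 dP Q4; rewrite predn_exp.
have e_gt0 : (0 < gcdn d Q.-1)%N by rewrite gcdn_gt0 d_gt0.
have t_d : (d %/ gcdn d Q.-1 %| d)%N by rewrite dvdn_div ?dvdn_gcdl.
rewrite -{1}(divnK (dvdn_gcdl d Q.-1)) -{3}(divnK (dvdn_gcdr d Q.-1)).
rewrite mulnAC dvdn_pmul2r // Gauss_dvdr ?coprime_div_gcd //.
apply: dvdn_geom_sum => //.
  by rewrite divn_gt0 // dvdn_leq ?dvdn_gcdl.
move=> p p_pr p_t; apply/eqP; rewrite eqn_mod_dvd 1?ltnW // subn1.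
exact: dP p_pr (dvdn_trans p_t t_d).
Qed.

Lemma dickson1_horner_addV (K : fieldType) (t : nat) (b z : K) : (0 < t)%N -> z != 0 ->
  (dickson1 t (b ^+ 2)).[b * z + b / z] = b ^+ t * (z ^+ t + (z ^+ t)^-1).
Proof.
move=> t_gt0 z0; rewrite (_ : b ^+ 2 = (b * z) * (b / z)); last by field.
by rewrite dickson1_hornerD // !exprMn exprVn mulrDr.
Qed.

(** Vanishing of the sum of (b z)^(n-i) (b / z)^i gives (b z)^(n+1) = (b / z)^(n+1). If z^2 = 1 all
    n + 1 terms equal (b z)^n, and their sum is nonzero. *)
Lemma dickson2_root_unity (K : fieldType) (n : nat) (b z : K) :
    b != 0 -> z != 0 -> n.+1%:R != 0 :> K ->
    root (dickson2 n (b ^+ 2)) (b * z + b / z) ->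
  z ^+ (2 * n.+1) = 1 /\ z ^+ 2 != 1.
Proof.
move=> b0 z0 n0; rewrite (_ : b ^+ 2 = (b * z) * (b / z)); last by field.
rewrite rootE dickson2_hornerD => /eqP sum0; split.
  have := subrXX (b * z) (b / z) n.+1; rewrite sum0 mulr0 => /eqP.
  rewrite subr_eq0 !exprMn (inj_eq (mulfI (expf_neq0 _ b0))) exprVn => /eqP zn.
  by rewrite mulnC exprM expr2 {1}zn mulVf ?expf_neq0.
apply: contra_neq n0 => z2.
have zV : z^-1 = z by apply: (mulfI z0); rewrite mulfV // -z2.
move: sum0; rewrite zV.
rewrite (eq_bigr (fun=> (b * z) ^+ n)) => [|i _].
  rewrite sumr_const card_ord => /eqP; rewrite -(mulr_natr ((b * z) ^+ n)) mulf_eq0.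
  case/orP=> [|/eqP//].
  by rewrite expf_eq0 mulf_eq0 (negPf b0) (negPf z0) andbF.
by rewrite -exprD subnK // -ltnS.
Qed.

Lemma dickson1_subC_monic_size (R : comNzRingType) (t : nat) (a c : R) : (0 < t)%N ->
  dickson1 t a - c%:P \is monic /\ size (dickson1 t a - c%:P) = t.+1.
Proof.
move=> t_gt0; have [mon size_t] := dickson1_monic_size a t_gt0.
have lt_size : (size (- c%:P) < size (dickson1 t a))%N.
  by rewrite size_polyN size_t (leq_ltn_trans (size_polyC_leq1 _)).
by rewrite monicE lead_coefDl // size_polyDl // size_t -monicE mon.
Qed.

(** * Irreducible factors of [dickson2 n a] over [F] *)

Theorem theorem4p3 (q : nat) (F L : finFieldType) (iota : {rmorphism F -> L})
    (cardF : #|F| = q) (cardL : #|L| = (q ^ 2)%N)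
    (q_mod4 : q = 3 %[mod 4])
    (a b : F) (a_neq0 : a != 0) (b_sqrt : b ^+ 2 = a)
    (n : nat) (n_odd : odd n) (rad_n : (radn n.+1 %| q - 1)%N)
    (f : {poly F}) (f_monic : f \is monic) (f_irr : irreducible_poly f)
    (f_dvd : f %| dickson2 n a) :
  exists (alpha : {unit L}) (t : nat),
    let al : L := val alpha in
    let fiber (c : L) : {poly L} :=
      map_poly iota (dickson1 t a) - (iota b ^+ t * (c + c^-1))%:P in
    [/\ (0 < t)%N,
        (t %| (2 * n.+1) %/ gcdn (2 * n.+1) (q - 1))%N &
    [/\ al ^+ ((2 * n.+1) %/ t)%N = 1,
        (radn t %| #[alpha]%g)%N,
        gcdn t ((q ^ 2 - 1) %/ #[alpha]%g) = 1%N &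
        (al, t) \notin [:: (1, 1%N); (-1, 1%N)]]] /\
    ((al \in codom iota) || (al ^+ q.+1 == 1) ->
       map_poly iota f = fiber al) /\
    (~~ ((al \in codom iota) || (al ^+ q.+1 == 1)) ->
       map_poly iota f = fiber al * fiber (al ^+ q)).
Proof.
have q_gt1 : (1 < q)%N by rewrite -cardF finNzRing_gt1.
have b0 : b != 0 by apply: contraNneq a_neq0 => b0; rewrite -b_sqrt b0 expr0n.
have n1_q p : prime p -> (p %| n.+1)%N -> (p %| q.-1)%N.
  by move=> p_pr p_n; rewrite -subn1 (dvdn_trans _ rad_n) // dvdn_prime_radn.
have q1_Q : (q.-1 %| (q ^ 2).-1)%N by rewrite predn_exp dvdn_mulr.
set N := (2 * n.+1)%N.
(* The extra factor 2 of N is harmless because q is odd. *)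
have N_q p : prime p -> (p %| N)%N -> (p %| q.-1)%N.
  move=> p_pr; rewrite Euclid_dvdM // => /orP[|/(n1_q p p_pr)//].
  by rewrite dvdn_prime2 // => /eqP->; lia.
have co_Nq : coprime N q.
  apply: contraT => nco.
  have g_gt1 : (1 < gcdn N q)%N by rewrite ltn_neqAle eq_sym nco gcdn_gt0.
  have := pdiv_dvd (gcdn N q); have p_pr := pdiv_prime g_gt1.
  set p := pdiv _ in p_pr *; rewrite dvdn_gcd => /andP[/(N_q p p_pr) p_q1 p_q].
  have : (p %| q.-1.+1)%N by rewrite prednK // ltnW.
  by rewrite -addn1 dvdn_addr // dvdn1 gtn_eqF // prime_gt1.
have [K [j _]] := countable_algebraic_closure L.
pose h : {rmorphism F -> K} := (j \o iota)%FUN.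
have [x fx0] : exists x, root (map_poly h f) x.
  by apply/closed_rootP; rewrite size_map_poly; case: f_irr => /gtn_eqF->.
have hb0 : h b != 0 by rewrite fmorph_eq0.
have [z z0 def_x] := closed_add_div x hb0.
have n1_neq0 : n.+1%:R != 0 :> K.
  have p_pr := pdiv_prime q_gt1; have p_q := pdiv_dvd q; set p := pdiv q in p_pr p_q.
  have pK : p \in [pchar K].
    rewrite -pnatE //; apply: pnat_dvd p_q _.
    by have := pchar_pnat_card_exp h 1; rewrite cardF expn1.
  rewrite -(dvdn_pcharf pK); apply: contraL co_Nq => p_n.
  apply: contraL (prime_gt1 p_pr) => /eqP co; rewrite -leqNgt dvdn_leq // -co.
  by rewrite dvdn_gcd p_q dvdn_mull.
have [zN z2] : z ^+ N = 1 /\ z ^+ 2 != 1.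
  apply: (@dickson2_root_unity _ n (h b)) => //.
  rewrite -def_x -rmorphXn b_sqrt -map_dickson2.
  by apply: root_dvdp fx0; rewrite dvdp_map.
have [d z_prim d_N] := prim_order_exists (isT : 0 < N)%N zN.
have d_gt0 := prim_order_gt0 z_prim.
pose Q := (q ^ 2)%N; pose e := gcdn d Q.-1; pose t := (d %/ e)%N.
have Q4 : Q = 1 %[mod 4] by rewrite /Q -modnXm q_mod4.
have Q_gt1 : (1 < Q)%N by rewrite -(exp1n 2) ltn_exp2r.
have d_Q p : prime p -> (p %| d)%N -> (p %| Q.-1)%N.
  by move=> p_pr p_d; apply: dvdn_trans q1_Q; apply: N_q (dvdn_trans p_d d_N).
have e_gt0 : (0 < e)%N by rewrite gcdn_gt0 d_gt0.
have te : (t * e = d)%N by rewrite divnK ?dvdn_gcdl.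
have t_gt0 : (0 < t)%N by rewrite divn_gt0 // dvdn_leq ?dvdn_gcdl.
have t_d : (t %| d)%N by rewrite -te dvdn_mulr.
have t_N := dvdn_trans t_d d_N.
have t_min m : z ^+ (Q ^ m) = z -> (t %| m)%N.
  move=> zQ; apply: dvdn_div_gcd_pred => //.
  have Qm_gt0 : (0 < Q ^ m)%N by rewrite expn_gt0 ltnW.
  by rewrite (prim_order_dvd z_prim) -(inj_eq (mulfI z0)) -exprS prednK // zQ mulr1.
have zt_prim : e.-primitive_root (z ^+ t).
  have := exp_prim_root z_prim t.
  by rewrite (gcdn_idPl t_d) -te mulKn.
(* The order e of z^t divides Q - 1, so z^t is fixed by the Q-Frobenius and comes from [L]. *)
have [al def_al] : exists al, j al = z ^+ t.
  have /codomP[al ->] : z ^+ t \in codom j; last by exists al.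
  rewrite mem_codom_frobenius cardL -/Q -[Q]prednK ?(ltnW Q_gt1) // exprS.
  have /eqP-> : (z ^+ t) ^+ Q.-1 == 1.
    by rewrite -(prim_order_dvd zt_prim) dvdn_gcdr.
  by rewrite mulr1.
have al0 : al != 0 by rewrite -(fmorph_eq0 j) def_al expf_neq0.
have al_unit : al \is a GRing.unit by rewrite unitfE.
pose alpha : {unit L} := FinRing.unit L al_unit.
have alphaX m : (alpha ^+ m == 1)%g = (e %| m)%N.
  rewrite -val_eqE FinRing.val_unitX /= -(inj_eq (fmorph_inj j)) rmorphXn rmorph1 /=.
  by rewrite def_al (prim_order_dvd zt_prim).
have ord_alpha : #[alpha]%g = e.
  by apply/eqP; rewrite eqn_dvd order_dvdn alphaX dvdnn -alphaX -order_dvdn dvdnn.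
exists alpha, t => /=.
pose fiber (c : L) : {poly L} :=
  map_poly iota (dickson1 t a) - (iota b ^+ t * (c + c^-1))%:P.
rewrite -!/(fiber _).
split.
  split=> //.
    rewrite dvdn_divRL ?dvdn_gcdl //.
    apply: dvdn_trans (dvdn_div_gcd_mul Q.-1 d_gt0 d_N).
    by rewrite dvdn_pmul2l // dvdn_gcd dvdn_gcdl (dvdn_trans (dvdn_gcdr _ _)) // subn1.
  split.
  - by apply: (fmorph_inj j); rewrite rmorphXn /= def_al -exprM mulnC divnK // rmorph1.
  - rewrite ord_alpha; apply: dvdn_radn => p p_pr p_t.
    have p_d := dvdn_trans p_t t_d.
    by rewrite dvdn_gcd p_d d_Q.
  - by apply/eqP; rewrite ord_alpha subn1; apply: coprime_div_gcd.
  (* For t = 1 one has [j al = z], so [al] equal to 1 or -1 would give z^2 = 1. *)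
  - apply: contraNN z2; rewrite !inE !xpair_eqE => /orP[]/andP[/eqP al1 /eqP t1];
      move: def_al; rewrite al1 t1 expr1 ?rmorphN rmorph1 => <-;
      by rewrite ?sqrrN expr1n.
have alQ m : al ^+ (Q ^ m) = al by rewrite /Q -cardL expf_card_exp.
have zq_al m : z ^+ (q ^ m) = z -> al ^+ (q ^ m) = al.
  by move=> zq; apply: (fmorph_inj j); rewrite rmorphXn /= def_al exprAC zq.
have zqV_al m : z ^+ (q ^ m) = z^-1 -> al ^+ (q ^ m) = al^-1.
  move=> zq; apply: (fmorph_inj j).
  by rewrite rmorphXn fmorphV /= def_al exprAC zq exprVn.
have frob_z m : x ^+ (q ^ m) = x -> z ^+ (q ^ m) = z \/ z ^+ (q ^ m) = z^-1.
  move=> xq; apply: add_inv_inj; rewrite ?expf_neq0 //; apply: (mulfI hb0).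
  have hbq : h b ^+ (q ^ m) = h b by rewrite -rmorphXn -cardF expf_card_exp.
  rewrite !mulrDr -def_x -xq {1}def_x -cardF frobeniusD // cardF !exprMn exprVn.
  by rewrite hbq.
have [D /andP[D_gt0 /eqP xD] D_min] : {D | (0 < D)%N && (x ^+ (q ^ D) == x) &
    forall i, (0 < i < D)%N -> x ^+ (q ^ i) != x}.
  (* Since q is prime to N, Euler's theorem gives q^totient(N) = 1 modulo N; this power fixes z,
     hence x. *)
  have exM : exists M, (0 < M)%N && (x ^+ (q ^ M) == x).
    exists (totient N); rewrite totient_gt0 /=.
    have zq : z ^+ (q ^ totient N) = z.
      by rewrite -(expr_mod _ zN) Euler_exp_totient 1?coprime_sym // (expr_mod _ zN).
    have hbq : h b ^+ (q ^ totient N) = h b by rewrite -rmorphXn -cardF expf_card_exp.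
    by rewrite def_x -cardF frobeniusD // cardF !exprMn exprVn hbq zq.
  case: (ex_minnP exM) => D D_ok D_min; exists D => // i /andP[i_gt0 lt_iD].
  by apply: contraTneq lt_iD => xi; rewrite -leqNgt D_min // i_gt0 xi eqxx.
have lt_Df : (D < size f)%N.
  by apply: (@frobenius_period_lt_size F K h f x); rewrite ?monic_neq0 // cardF.
have t_D : (t %| D)%N.
  (* Applying the D-th Frobenius power twice undoes a possible inversion of z, and q^D squared is
     Q^D. *)
  apply: t_min; rewrite /Q -expnM mulnC expnM -mulnn exprM.
  by case: (frob_z D xD) => zD; rewrite zD ?exprVn zD ?invrK.
have size_f : (t < size f)%N by apply: leq_ltn_trans lt_Df; apply: dvdn_leq.
have fiberE c : fiber c = dickson1 t (iota a) - (iota b ^+ t * (c + c^-1))%:P.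
  by rewrite /fiber map_dickson1.
have [fiber_monic size_fiber] : (forall c, fiber c \is monic)
    /\ (forall c, size (fiber c) = t.+1).
  by split=> c; rewrite fiberE; have [] := @dickson1_subC_monic_size L t (iota a)
    (iota b ^+ t * (c + c^-1)) t_gt0.
have fiber_root : root (map_poly j (fiber al)) x.
  rewrite fiberE rmorphB /= map_dickson1 map_polyC rootE !hornerE def_x.
  rewrite -[j (iota a)]/(h a) -b_sqrt rmorphXn dickson1_horner_addV //.
  by rewrite /= rmorphM rmorphXn rmorphD fmorphV /= def_al subrr.
have frobL (u v : L) : (u + v) ^+ q = u ^+ q + v ^+ q.
  by have := frobeniusD iota 1 u v; rewrite cardF expn1.
have codomF (u : L) : u ^+ q = u -> exists c, u = iota c.
  by move=> uq; apply/codomP; rewrite mem_codom_frobenius cardF uq.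
(* [f] divides every polynomial over [F] vanishing at x, hence equals a monic one that is no
   larger. *)
have f_eq (r : {poly L}) g : map_poly iota g = r -> r \is monic ->
    (size r <= size f)%N -> root (map_poly j r) x -> map_poly iota f = r.
  move=> <-; rewrite map_monic size_map_poly => g_monic le_gf gx0.
  rewrite (@monic_dvdp_eq _ f g) //; apply: irreducible_dvdp_root fx0 _ => //.
  by rewrite map_poly_comp.
split=> [in_a|].
  (* In case (a), al^q is [al] or its inverse, so al + 1/al is fixed by Frobenius. *)
  have [c def_c] : exists c, al + al^-1 = iota c.
    apply: codomF; rewrite frobL exprVn.
    case/orP: in_a => [|/eqP alq]; first by rewrite mem_codom_frobenius cardF => /eqP->.
    have -> : al ^+ q = al^-1 by apply: (mulfI al0); rewrite -exprS alq mulfV.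
    by rewrite invrK addrC.
  apply: (f_eq _ (dickson1 t a - (b ^+ t * c)%:P)); rewrite ?size_fiber //.
  by rewrite rmorphB /= map_polyC /= rmorphM rmorphXn /= -def_c.
rewrite negb_or mem_codom_frobenius cardF => /andP[al_q al_q1].
(* Suppose D = t. For odd t, al^(q^t) = al^q would be [al] or its inverse, both excluded. For even
   t, q^t = Q^(t/2): if this power fixes z then t | t/2; if it inverts z then d, a multiple of 4 as
   t and e are even, divides Q^(t/2) + 1, which is 2 modulo 4. *)
have neq_Dt : D != t.
  apply: contraNneq al_q => eq_Dt; rewrite eq_Dt in xD.
  have al_qV : al ^+ q != al^-1.
    by apply: contraNneq al_q1 => alq; rewrite exprS alq mulfV.
  have [t_odd|t_even] := boolP (odd t).
    have al_qt : al ^+ (q ^ t) = al ^+ q.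
      by rewrite -(odd_double_half t) t_odd add1n expnS -mul2n expnM mulnC exprM alQ.
    case: (frob_z t xD) => [/zq_al|/zqV_al]; rewrite al_qt; first by move=> ->.
    by move=> alq; rewrite alq eqxx in al_qV.
  have def_t : t = (2 * t./2)%N by rewrite mul2n even_halfK.
  have qtE : (q ^ t = Q ^ t./2)%N by rewrite {1}def_t expnM.
  have [] := frob_z t xD; rewrite qtE => zqt.
    have half_gt0 : (0 < t./2)%N by move: t_gt0; rewrite {1}def_t muln_gt0.
    have half_lt : (t./2 < t)%N by rewrite {2}def_t ltn_Pmull.
    by have := t_min _ zqt; rewrite gtnNdvd.
  have : (4 %| (Q ^ t./2).+1)%N.
    apply: (@dvdn_trans d); last by rewrite (prim_order_dvd z_prim) exprS zqt mulfV.
    have d2 : (2 %| d)%N by rewrite -te dvdn_mulr // dvdn2.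
    have e2 : (2 %| e)%N by rewrite dvdn_gcd d2 d_Q.
    by rewrite -te (@dvdn_mul 2 2) // dvdn2.
  by rewrite /dvdn -addn1 -modnDml -modnXm Q4 modnXm exp1n.
have le_2tD : (2 * t <= D)%N.
  case/dvdnP: t_D neq_Dt D_gt0 => [[|[|k]]] ->; rewrite ?mul1n ?eqxx // => _ _.
  by rewrite leq_pmul2r.
set s := al + al^-1.
have sq : (s ^+ q) = al ^+ q + (al ^+ q)^-1 by rewrite frobL exprVn.
have sqq : (s ^+ q) ^+ q = s.
  by rewrite -exprM mulnn -cardL expf_card.
(* The trace and norm of s lie in [F]; they give the coefficients of [g], the product of the two
   conjugate fibers as a quadratic in [dickson1 t a]. *)
have [c1 def_c1] : exists c, s + s ^+ q = iota c.
  by apply: codomF; rewrite frobL sqq addrC.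
have [c2 def_c2] : exists c, s * s ^+ q = iota c.
  by apply: codomF; rewrite exprMn sqq mulrC.
pose g := dickson1 t a * dickson1 t a - (b ^+ t * c1)%:P * dickson1 t a
  + (b ^+ t * b ^+ t * c2)%:P.
apply: (f_eq _ g).
- rewrite !fiberE -/s -sq /g rmorphD rmorphB !rmorphM /= !map_polyC map_dickson1 /=.
  rewrite (rmorphXn iota) /= -def_c1 -def_c2 polyCM polyCD; ring.
- by rewrite monicMl.
- rewrite size_monicM ?monic_neq0 // !size_fiber addnS addSn addnn -mul2n.
  exact: leq_ltn_trans le_2tD lt_Df.
- by rewrite rmorphM rootM fiber_root.
Qed.
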